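(* For the generic symmetric $n\times n$ matrix $X=(x_{ij})$, the ideal $\mathrm{Ann}(\det(X))\subset S$ includes the following degree $2$ polynomials: (a) the monomials $y_{ii}y_{ij}$ for all $1\le i,j\le n$ ($i=j$ is allowed); the number of these monomials is $n^2$; (b) the binomials $y_{ij}^2+2y_{ii}y_{jj}$ ($i\ne j$); the number of these binomials is $\binom n2$; (c) the binomials $y_{ji}y_{il}+y_{jl}y_{ii}$ ($i,j,l$ pairwise distinct), i.e. the $2\times2$ permanents of $Y$ with one diagonal element; the number of these binomials is $n\binom{n-1}{2}$; (d) the hafnians $y_{i_1i_2}y_{i_3i_4}+y_{i_1i_3}y_{i_2i_4}+y_{i_1i_4}y_{i_2i_3}$, $i_1<i_2<i_3<i_4$, of all symmetrically chosen $4\times4$ submatrices of $Y$; the number of these trinomials is $\binom n4$.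
   Context: Let $\mathsf k$ be an infinite field of characteristic zero or characteristic $p>2$. $X=(x_{ij})$ is the generic symmetric $n\times n$ matrix: its entries $x_{ij}=x_{ji}$, $1\le i\le j\le n$, are $n(n+1)/2$ distinct variables. $R=\mathsf k[x_{ij}: i\le j]$ and $S=\mathsf k[y_{ij}: i\le j]$, with $y_{ij}=y_{ji}$; $Y=(y_{ij})$. $S$ acts on $R$ by differentiation: $y_{ij}$ acts as $\partial/\partial x_{ij}$, and the action of $h\in S$ on $F\in R$ is written $h\circ F$. $\mathrm{Ann}(F)=\{h\in S: h\circ F=0\}$. *)

(* Defs.v *)
From HB Require Import structures.
From mathcomp Require Import all_boot all_order all_fingroup all_algebra.
From mathcomp Require Import finmap mpoly.

Set Implicit Arguments.
Unset Strict Implicit.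
Unset Printing Implicit Defensive.

Import GRing.Theory.
Local Open Scope fset_scope.
Local Open Scope ring_scope.

Definition infinite_type (T : eqType) : Prop :=
  forall s : seq T, exists x : T, x \notin s.

Definition symidx (n : nat) := {ij : 'I_n * 'I_n | (ij.1 <= ij.2)%N}.

Definition sort_pair (n : nat) (i j : 'I_n) : 'I_n * 'I_n :=
  if (i <= j)%N then (i, j) else (j, i).

Lemma sort_pairP (n : nat) (i j : 'I_n) :
  ((sort_pair i j).1 <= (sort_pair i j).2)%N.
Proof. by rewrite /sort_pair; case: (leqP i j) => [//|/ltnW]. Qed.

Definition mk_symidx (n : nat) (i j : 'I_n) : symidx n :=
  Sub (sort_pair i j) (sort_pairP i j).

Definition nsymvar (n : nat) : nat := #|{: symidx n}|.

(* R = k[x_ij] and S = k[y_ij] are both the polynomial ring in nsymvar n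
   variables, so genericsym below plays the role of X in R and of Y in S. *)
Notation symR k n := {mpoly k[nsymvar n]}.
Notation symS k n := {mpoly k[nsymvar n]}.

Definition genericsym (k : fieldType) (n : nat) : 'M[{mpoly k[nsymvar n]}]_n :=
  \matrix_(i, j) 'X_(enum_rank (mk_symidx i j)).

(* mderivm m is the composite of the partial derivatives prescribed by m;
   no division by factorials takes place. *)
Definition diffact (k : fieldType) (n : nat) (h : symS k n) (F : symR k n) :
    symR k n :=
  \sum_(m <- msupp h) h@_m *: mderivm m F.

Definition Ann (k : fieldType) (n : nat) (F : symR k n) : {pred symS k n} :=
  [pred h | diffact h F == 0].

Definition permanent (A : comNzRingType) (n : nat) (M : 'M[A]_n) : A :=
  \sum_(s : 'S_n) \prod_i M i (s i).

(* Perfect matchings of 'I_n are encoded as the fixed-point-free involutions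
   of 'I_n; each pair {i, s i} contributes the entry above the diagonal. *)
Definition hafnian (A : comNzRingType) (n : nat) (M : 'M[A]_n) : A :=
  \sum_(s : 'S_n | [forall i, (s i != i) && (s (s i) == i)])
     \prod_(i : 'I_n | (i < s i)%N) M i (s i).

Definition increasing (m n : nat) (f : {ffun 'I_m -> 'I_n}) : bool :=
  [forall a : 'I_m, forall b : 'I_m, (a < b)%N ==> (f a < f b)%N].

Section Quadrics.

Variables (A : comNzRingType) (n : nat) (Y : 'M[A]_n).

Definition diag_monomials : {fset A} :=
  [fset Y i i * Y i j | i : 'I_n, j : 'I_n].

Definition square_binomials : {fset A} :=
  [fset Y p.1 p.2 ^+ 2 + 2 * (Y p.1 p.1 * Y p.2 p.2)
    | p : 'I_n * 'I_n & p.1 != p.2].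

Definition diag_binomials : {fset A} :=
  [fset Y t.1.2 t.1.1 * Y t.1.1 t.2 + Y t.1.2 t.2 * Y t.1.1 t.1.1
    | t : 'I_n * 'I_n * 'I_n
    & [&& t.1.1 != t.1.2, t.1.1 != t.2 & t.1.2 != t.2]].

Definition hafnian_trinomials : {fset A} :=
  [fset Y t.1.1.1 t.1.1.2 * Y t.1.2 t.2 + Y t.1.1.1 t.1.2 * Y t.1.1.2 t.2
        + Y t.1.1.1 t.2 * Y t.1.1.2 t.1.2
    | t : 'I_n * 'I_n * 'I_n * 'I_n
    & [&& (t.1.1.1 < t.1.1.2)%N, (t.1.1.2 < t.1.2)%N & (t.1.2 < t.2)%N]].

(* An entry (a, b) of the submatrix with rows r and columns c is a diagonal
   entry of Y when r a = c b. *)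
Definition one_diag_permanents : {fset A} :=
  [fset permanent (mxsub (fun_of_fin r) (fun_of_fin c) Y)
    | r : {ffun 'I_2 -> 'I_n}, c : {ffun 'I_2 -> 'I_n}
    & [&& increasing r, increasing c
        & #|[set ab : 'I_2 * 'I_2 | r ab.1 == c ab.2]| == 1%N]].

Definition principal_hafnians : {fset A} :=
  [fset hafnian (mxsub (fun_of_fin f) (fun_of_fin f) Y)
    | f : {ffun 'I_4 -> 'I_n} & increasing f].

End Quadrics.

(* Main.v *)
Require Import Defs.
From mathcomp Require Import all_boot all_order all_fingroup all_algebra.
From mathcomp Require Import finmap mpoly.
From mathcomp Require Import ssrcomplements zify ring.

(** The annihilation statements come from one formula for the second
    derivatives of [\det X].  In the Leibniz expansion, [x_ab] occurs at the
    positions [(a, b)] and [(b, a)], so differentiating by [x_ab] and then by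
    [x_cd] removes from each term one factor at a position in [(a, b), (b, a)]
    and another at a position in [(c, d), (d, c)].  Hence the second derivative
    is a sum of at most four signed minors [minor2 i i' j j'], obtained by
    deleting the rows [i], [j] and the columns [i'], [j'] ([mderiv2_det]).
    Such a minor vanishes when [i = j] or [i' = j'], and changes sign when the
    two columns are exchanged ([minor2_swap]).  In each of the four types of
    quadrics, the minors that appear vanish or cancel in pairs under this
    exchange.  For the hafnians, say, the twelve minors are indexed by the ways
    to write [{i1, i2, i3, i4}] as two disjoint oriented edges, and exchanging
    the heads of the two edges pairs them off.

    For the sizes of the families, each quadric has coefficient 1 at a
    distinguished monomial, and that monomial occurs in another member of the
    family only if both are indexed by the same combinatorial object: an
    ordered pair of indices in (a), a two-element set in (b), a point with a
    two-element set avoiding it in (c), an increasing quadruple in (d).  The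
    lemma [card_imfset_fibers] turns this into an equality of cardinals.  The
    same coefficient shows that the quadrics are nonzero, so that they have
    degree exactly 2.

    The identification of the explicit binomials in (c) and trinomials in (d)
    with permanents and hafnians amounts to listing the permutations of two
    points ([permanent2]) and the perfect matchings of four ([hafnian4]). *)

Set Implicit Arguments.
Unset Strict Implicit.
Unset Printing Implicit Defensive.

Import GRing.Theory.
Local Open Scope fset_scope.
Local Open Scope ring_scope.

(** * Polynomials acting as differential operators *)

Section Action.
Variables (k : fieldType) (n : nat).
Implicit Types (h g : symS k n) (F : symR k n).

(** Summing over a fixed finite set of monomials that contains the support
    is what makes linearity in [h] visible. *)
Lemma diffact_widen d h F : (msize h <= d)%N ->
  diffact h F = \sum_(m : 'X_{1..(nsymvar n) < d}) h@_m *: mderivm m F.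
Proof.
move=> le_hd; pose I : subFinType _ := 'X_{1..(nsymvar n) < d}.
rewrite /diffact (big_mksub I) /=; first last.
- by move=> m /msize_mdeg_lt /leq_trans; apply.
- exact: msupp_uniq.
rewrite big_rmcond //= => m /memN_msupp_eq0 ->; exact: scale0r.
Qed.

Lemma diffactD h g F : diffact (h + g) F = diffact h F + diffact g F.
Proof.
pose d := maxn (msize h) (msize g).
rewrite !(@diffact_widen d) ?leq_maxl ?leq_maxr ?msizeD_le //.
by rewrite -big_split; apply: eq_bigr => m _; rewrite mcoeffD scalerDl.
Qed.

Lemma diffactXX u v F : diffact ('X_u * 'X_v) F = mderiv v (mderiv u F).
Proof.
rewrite -mpolyXD /diffact msuppX big_seq1 mcoeffX eqxx scale1r.
by rewrite mderivmDm !mderivmU1m.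
Qed.

Lemma AnnE h F : (h \in Ann F) = (diffact h F == 0 :> symR k n).
Proof. by []. Qed.

End Action.

Section ProductRule.
Variables (R : comNzRingType) (N : nat).

Lemma mderiv_sum (I : Type) (r : seq I) (P : pred I) (f : I -> {mpoly R[N]}) v :
  mderiv v (\sum_(i <- r | P i) f i) = \sum_(i <- r | P i) mderiv v (f i).
Proof. exact: raddf_sum. Qed.

Lemma mderiv_prod (I : finType) (P : pred I) (f : I -> {mpoly R[N]}) v :
  mderiv v (\prod_(i | P i) f i) =
  \sum_(i | P i) mderiv v (f i) * \prod_(j | P j && (j != i)) f j.
Proof.
have [c] := ubnP #|P|; elim: c P => // c IHc P cardP.
have [i0 Pi0 | P0] := pickP P; last by rewrite !big_pred0 // -mpolyC1 mderivC.
rewrite (bigD1 i0) //= mderivM IHc; last first.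
  rewrite (cardD1 i0) unfold_in Pi0 in cardP.
  by rewrite (eq_card (B := [predD1 P & i0])) // => i; rewrite !inE andbC.
rewrite [RHS](bigD1 i0) //= mulr_sumr; congr (_ + _).
apply: eq_bigr => i /andP[Pi i0i].
rewrite [in RHS](bigD1 i0) /= ?Pi0 1?eq_sym // mulrCA.
by congr (_ * (_ * _)); apply: eq_bigl => j; rewrite andbAC.
Qed.

End ProductRule.

(** * Second derivatives of the generic symmetric determinant *)

Lemma eq_set2 (T : finType) (i j a b : T) :
  ([set i; j] == [set a; b]) =
  ((i == a) && (j == b)) || ((i == b) && (j == a)).
Proof.
apply/eqP/idP => [E|/orP[]/andP[/eqP-> /eqP->] //]; last by rewrite setUC.
have: [&& i \in [set a; b], j \in [set a; b], a \in [set i; j]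
        & b \in [set i; j]].
  by rewrite -E set21 set22 E set21 set22.
rewrite !inE ![_ == i]eq_sym ![_ == j]eq_sym.
by do 4 case: (_ == _).
Qed.

Section SecondDerivatives.
Variables (k : fieldType) (n : nat).
Local Notation X := (genericsym k n).
Implicit Types (a b c d i j l : 'I_n).

Definition symvar i j : 'I_(nsymvar n) := enum_rank (mk_symidx i j).

(** Indices are seen as vertices and variables as edges (or loops) of the
    complete graph with loops; this compares unoriented edges. *)
Definition sameedge i j a b :=
  ((i == a) && (j == b)) || ((i == b) && (j == a)).

Lemma symvar_eq i j a b : (symvar i j == symvar a b) = sameedge i j a b.
Proof.
rewrite (inj_eq enum_rank_inj) -val_eqE /= /sameedge /sort_pair.
rewrite -!(inj_eq val_inj) /=.
case: (leqP i j) => ?; case: (leqP a b) => ?;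
  by rewrite xpair_eqE -!(inj_eq val_inj) /=; lia.
Qed.

Lemma mderiv_genericsym a b i j :
  mderiv (symvar a b) (X i j) = (sameedge i j a b)%:R.
Proof.
rewrite mxE mderivX mnm1E -/(symvar i j) symvar_eq.
case: (boolP (sameedge _ _ _ _)) => [|_]; last by rewrite scale0r.
rewrite -symvar_eq scale1r => /eqP <-.
by rewrite -{1}[U_(_)%MM]add0m addmK mpolyX0.
Qed.

(** A loop has one orientation and an edge between distinct vertices has two,
    as a diagonal variable occurs once in [X] and any other variable twice. *)
Definition edge_sum (V : nmodType) a b (f : 'I_n -> 'I_n -> V) : V :=
  if a == b then f a a else f a b + f b a.

Lemma edge_sumE (V : nzRingType) (s : 'S_n) a b (f : 'I_n -> V) :
  \sum_i (sameedge i (s i) a b)%:R * f i =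
  edge_sum a b (fun i j => (s i == j)%:R * f i).
Proof.
rewrite /edge_sum /sameedge (bigD1 a) //= eqxx /=.
case: (eqVneq a b) => [<-|neq_ab] /=.
  by rewrite orbb big1 ?addr0 // => i /negPf->; rewrite mul0r.
rewrite orbF (bigD1 b) 1?eq_sym //= [b == a]eq_sym (negPf neq_ab) eqxx /=.
rewrite big1 ?addr0 //.
by move=> i /andP[/negPf-> /negPf->]; rewrite mul0r.
Qed.

(** Up to sign, the minor of [X] without the rows [i], [j] and the columns [a],
    [b].  As a partial Leibniz sum it carries the right sign for the expansion
    of the determinant, and is defined, with value 0, when [i = j] or
    [a = b]. *)
Definition minor2 i a j b : symR k n :=
  \sum_(s : 'S_n | [&& i != j, s i == a & s j == b])
    (-1) ^+ s * \prod_(m | (m != i) && (m != j)) X m (s m).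

Lemma minor2_row i a b : minor2 i a i b = 0.
Proof. by rewrite /minor2 big_pred0 // => s; rewrite eqxx. Qed.

Lemma minor2_col i j a : minor2 i a j a = 0.
Proof.
rewrite /minor2 big_pred0 // => s.
by apply/and3P => -[/eqP ij /eqP <- /eqP /perm_inj /esym/ij].
Qed.

(** Composing with the transposition of [i] and [j] reverses the sign of a
    permutation and does not move the remaining factors. *)
Lemma minor2_swap i a j b : minor2 i a j b = - minor2 i b j a.
Proof.
have [<-|neq_ij] := eqVneq i j; first by rewrite !minor2_row oppr0.
rewrite /minor2 (reindex_inj (mulgI (tperm i j))) -sumrN.
apply: eq_big => s.
  by rewrite !permM tpermL tpermR neq_ij /= andbC.
move=> _; rewrite odd_permM odd_tperm neq_ij signr_addb expr1 mulN1r mulNr.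
congr (- (_ * _)); apply: eq_bigr => m /andP[mi mj].
by rewrite permM tpermD // eq_sym.
Qed.

Lemma minor2C i a j b : minor2 i a j b = minor2 j b i a.
Proof.
apply: eq_big => s; first by rewrite eq_sym [(s i == a) && _]andbC.
by move=> _; congr (_ * _); apply: eq_bigl => m; rewrite andbC.
Qed.

Lemma minor2_swap_row i a j b : minor2 i a j b = - minor2 j a i b.
Proof. by rewrite minor2_swap minor2C. Qed.

(** The product rule applied twice to the Leibniz expansion: each derivative
    replaces one factor [X i (s i)] by 0 or 1, and for a fixed edge only its
    orientations [(i, s i)] contribute. *)
Lemma mderiv2_det a b c d :
  mderiv (symvar c d) (mderiv (symvar a b) (\det X)) =
  edge_sum a b (fun i i' => edge_sum c d (fun j j' => minor2 i i' j j')).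
Proof.
pose T (s : 'S_n) i j := \prod_(m | (m != i) && (m != j)) X m (s m).
transitivity (\sum_(s : 'S_n) (-1) ^+ s *
    edge_sum a b (fun i i' => (s i == i')%:R *
      edge_sum c d (fun j j' => (s j == j')%:R * ((i != j)%:R * T s i j)))).
  rewrite /determinant [mderiv (symvar a b) _]mderiv_sum mderiv_sum.
  apply: eq_bigr => s _.
  rewrite !raddfMsign /= -edge_sumE mderiv_prod mderiv_sum; congr (_ * _).
  apply: eq_bigr => i _; rewrite mderiv_genericsym !mulr_natl raddfMn /=.
  rewrite mderiv_prod -edge_sumE; congr (_ *+ _).
  rewrite [LHS]big_mkcond; apply: eq_bigr => j _; rewrite mderiv_genericsym.
  by rewrite eq_sym; case: eqP => _; rewrite /T ?mul0r ?mulr0 ?mul1r.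
have minor2E i i' j j' : minor2 i i' j j' =
    \sum_(s : 'S_n) (-1) ^+ s * ((s i == i')%:R * ((s j == j')%:R *
       ((i != j)%:R * T s i j))).
  rewrite /minor2 big_mkcond; apply: eq_bigr => s _.
  by do 3 case: eqP => _; rewrite /= ?mul1r ?mul0r ?mulr0.
rewrite /edge_sum; case: eqP => _; case: eqP => _; rewrite !minor2E -?big_split;
  by apply: eq_bigr => s _; rewrite /= ?mulrDr.
Qed.

Lemma diffact_quadric a b c d :
  diffact (X a b * X c d) (\det X) =
  edge_sum a b (fun i i' => edge_sum c d (fun j j' => minor2 i i' j j')).
Proof. by rewrite -mderiv2_det !mxE diffactXX. Qed.

(** * The quadrics annihilate the determinant *)

(** Both orientations of [ij] share with the loop [ii] either the row [i] or
    the column [i]. *)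
Lemma diag_monomial_Ann i j : X i i * X i j \in Ann (\det X).
Proof.
rewrite AnnE diffact_quadric /edge_sum eqxx /=.
by case: (i == j); rewrite !minor2_row ?minor2_col ?addr0.
Qed.

(** Exchanging columns turns the pair of positions [(i, j)], [(j, i)] into the
    pair [(i, i)], [(j, j)]; the former is counted twice in the second
    derivative by [x_ij], which explains the coefficient 2. *)
Lemma square_binomial_Ann i j : i != j ->
  X i j ^+ 2 + 2 * (X i i * X j j) \in Ann (\det X).
Proof.
move=> /negPf neq_ij.
rewrite AnnE mulr_natl mulr2n !diffactD !diffact_quadric /edge_sum.
rewrite !eqxx neq_ij /= !minor2_row (minor2_swap i j j i) (minor2C j i i j).
by rewrite (minor2_swap i j j i); apply/eqP; ring.
Qed.

Lemma diag_binomial_Ann i j l : i != j -> i != l -> j != l ->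
  X j i * X i l + X j l * X i i \in Ann (\det X).
Proof.
move=> /negPf ij /negPf il /negPf jl.
rewrite AnnE diffactD !diffact_quadric /edge_sum.
rewrite eqxx jl il [j == i]eq_sym ij /= !minor2_row !minor2_col.
rewrite (minor2_swap j i i l) (minor2_swap i j l i) (minor2C i i l j).
by apply/eqP; ring.
Qed.

Lemma hafnian_trinomial_Ann (i1 i2 i3 i4 : 'I_n) : uniq [:: i1; i2; i3; i4] ->
  X i1 i2 * X i3 i4 + X i1 i3 * X i2 i4 + X i1 i4 * X i2 i3 \in Ann (\det X).
Proof.
move=> Ui; rewrite /= !inE !negb_or andbT in Ui.
case/and3P: Ui => /and3P[/negPf i12 /negPf i13 /negPf i14].
case/andP=> /negPf i23 /negPf i24 /negPf i34.
rewrite AnnE !diffactD !diffact_quadric /edge_sum i12 i13 i14 i23 i24 i34 /=.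
(* Each of the six rewrites turns one of the twelve minors into the opposite
   of another one. *)
rewrite (minor2_swap i1 i2 i3 i4) (minor2_swap i1 i2 i4 i3).
rewrite (minor2_swap i1 i3 i2 i4) (minor2_swap_row i2 i1 i3 i4).
rewrite (minor2_swap_row i2 i1 i4 i3) (minor2_swap_row i3 i1 i4 i2).
by apply/eqP; ring.
Qed.

End SecondDerivatives.

(** * Coefficients of the quadrics at distinguished monomials *)

Lemma mnmU2_eq N (u v u' v' : 'I_N) :
  (U_(u) + U_(v) == U_(u') + U_(v'))%MM =
  ((u == u') && (v == v')) || ((u == v') && (v == u')).
Proof.
apply/eqP/idP => [/mnmP E|/orP[]/andP[/eqP-> /eqP->] //]; last exact: addmC.
have := (E u, E v, E u', E v'); rewrite !mnmDE !mnm1E !eqxx.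
rewrite [v == u]eq_sym [v' == u']eq_sym [u' == u]eq_sym [u' == v]eq_sym.
rewrite [v' == u]eq_sym [v' == v]eq_sym.
by do 6 case: (_ == _) => //=; case=> [[[]]].
Qed.

Section Coefficients.
Variables (k : fieldType) (n : nat).
Local Notation X := (genericsym k n).
Implicit Types (a b c d i j l : 'I_n).

Definition quadmon a b c d : 'X_{1..nsymvar n} :=
  (U_(symvar a b) + U_(symvar c d))%MM.

Lemma mdeg_quadmon a b c d : mdeg (quadmon a b c d) = 2%N.
Proof. by rewrite mdegD !mdeg1. Qed.

Lemma genericsymM a b c d : X a b * X c d = 'X_[quadmon a b c d].
Proof. by rewrite !mxE mpolyXD. Qed.

Lemma genericsymC a b : X a b = X b a.
Proof.
by rewrite !mxE; congr 'X_(_); apply/eqP; rewrite symvar_eq /sameedge !eqxx orbT.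
Qed.

Lemma sameedge_set i j a b : sameedge i j a b = ([set i; j] == [set a; b]).
Proof. by rewrite eq_set2. Qed.

Lemma sameedge_loopl a i j : i != j -> sameedge a a i j = false.
Proof. by rewrite /sameedge -!(inj_eq val_inj) /=; lia. Qed.

Lemma sameedge_loopr i j a : i != j -> sameedge i j a a = false.
Proof. by rewrite /sameedge -!(inj_eq val_inj) /=; lia. Qed.

Lemma sameedge_loop a b : sameedge a a b b = (a == b).
Proof. by rewrite /sameedge orbb andbb. Qed.

Lemma sameedge_lt i j a b : (i < j)%N -> (a < b)%N ->
  sameedge i j a b = (i == a) && (j == b).
Proof. by rewrite /sameedge -!(inj_eq val_inj) /=; lia. Qed.

Lemma mcoeff_quadric a b c d a' b' c' d' :
  (X a' b' * X c' d')@_(quadmon a b c d) =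
  (sameedge a' b' a b && sameedge c' d' c d
   || sameedge a' b' c d && sameedge c' d' a b)%:R.
Proof. by rewrite genericsymM mcoeffX mnmU2_eq !symvar_eq. Qed.

Lemma mcoeff_diag_monomial i j i' j' :
  (X i' i' * X i' j')@_(quadmon i i i j) = ((i', j') == (i, j))%:R.
Proof.
rewrite mcoeff_quadric xpair_eqE /sameedge -!(inj_eq val_inj) /=.
congr (nat_of_bool _)%:R; lia.
Qed.

Lemma mcoeff_square_binomial i j i' j' : i != j ->
  (X i' j' ^+ 2 + 2 * (X i' i' * X j' j'))@_(quadmon i j i j) =
  (sameedge i' j' i j)%:R.
Proof.
move=> ij; rewrite mulr_natl mulr2n !mcoeffD !mcoeff_quadric.
by rewrite !(sameedge_loopl _ ij) orbb andbb !addr0.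
Qed.

(** Only the second monomial contains a loop variable: the loop gives back the
    point [i], and the other variable the edge [jl]. *)
Lemma mcoeff_diag_binomial i j l i' j' l' :
    [&& i' != j', i' != l' & j' != l'] -> j != l ->
  (X j' i' * X i' l' + X j' l' * X i' i')@_(quadmon j l i i) =
  ((i' == i) && sameedge j' l' j l)%:R.
Proof.
case/and3P=> ij' il' jl' jl; rewrite mcoeffD !mcoeff_quadric.
have ji' : j' != i' by rewrite eq_sym.
rewrite !(sameedge_loopr i ji', sameedge_loopr i il', sameedge_loopr i jl').
by rewrite !andbF !orbF add0r sameedge_loop [in RHS]andbC.
Qed.

Lemma mcoeff_hafnian_trinomial a b c d a' b' c' d' :
    [&& a < b, b < c & c < d]%N -> [&& a' < b', b' < c' & c' < d']%N ->
  (X a' b' * X c' d' + X a' c' * X b' d'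
   + X a' d' * X b' c')@_(quadmon a b c d) =
  ((a', b', c', d') == (a, b, c, d))%:R.
Proof.
case/and3P=> ab bc cd /and3P[ab' bc' cd'].
have [ac' bd'] := (ltn_trans ab' bc', ltn_trans bc' cd').
have ad' := ltn_trans ab' bd'.
rewrite !mcoeffD !mcoeff_quadric !sameedge_lt // !xpair_eqE.
rewrite -!(inj_eq val_inj) /=.
(* Among the three matchings of an increasing quadruple, only the first one has
   all entries of one edge below those of the other. *)
transitivity ([&& (a' == a :> nat), (b' == b :> nat), (c' == c :> nat)
    & (d' == d :> nat)]%:R + false%:R + false%:R : k).
  by congr ((nat_of_bool _)%:R + (nat_of_bool _)%:R + (nat_of_bool _)%:R); lia.
by rewrite !addr0 -!andbA.
Qed.

Lemma msize_genericsymM a b c d : msize (X a b * X c d) = 3%N.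
Proof. by rewrite genericsymM msizeX mdeg_quadmon. Qed.

Lemma msize_quadricD (p q : symR k n) :
  (msize p <= 3 -> msize q <= 3 -> msize (p + q) <= 3)%N.
Proof. by move=> p3 q3; rewrite (leq_trans (msizeD_le _ _)) // geq_max p3. Qed.

Lemma msize_quadric (h : symS k n) a b c d :
  (msize h <= 3)%N -> h@_(quadmon a b c d) != 0 -> msize h = 3%N.
Proof.
move=> h3 hm; apply/eqP; rewrite eqn_leq h3 -(mdeg_quadmon a b c d).
by rewrite msize_mdeg_lt // mcoeff_msupp.
Qed.

Lemma natr_bool_eq1 (b : bool) : b%:R = 1 :> k -> b.
Proof. by case: b => // /esym/eqP; rewrite oner_eq0. Qed.

End Coefficients.

(** * Counting the index sets *)

(** An image is counted by its fibers: it suffices to find an easily counted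
    [g] with the same fibers as [f]. *)
Lemma card_imfset_fibers (T T' : finType) (K : choiceType) key
    (p : finmempred T) (P : {pred T}) (f : T -> K) (g : T -> T') :
    (forall x, in_mem x p = (x \in P)) ->
    {in P &, forall x y, f x = f y <-> g x = g y} ->
  #|` imfset key f p| = #|[set g x | x in P]|.
Proof.
move=> pE fg; have [x0 Px0 | P0] := pickP P; last first.
  rewrite (_ : [set g x | x in P] = set0); last first.
    by apply/setP => y; rewrite inE; apply/imsetP => -[x]; rewrite unfold_in P0.
  rewrite cards0; apply/eqP; rewrite cardfs_eq0; apply/eqP/fsetP => y.
  by rewrite inE; apply/imfsetP => -[x /=]; rewrite pE unfold_in P0.
(* [r] chooses a representative in each fiber of [g]. *)
pose r y := odflt x0 [pick x in P | g x == y].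
have rP x : x \in P -> (r (g x) \in P) * (g (r (g x)) = g x).
  move=> Px; rewrite /r; case: pickP => [z /andP[Pz /eqP gz] //|/(_ x)].
  by rewrite Px eqxx.
have -> : imfset key f p = [fset f (r y) | y in g @: P].
  apply/fsetP => z; apply/imfsetP/imfsetP => /= -[x Px ->].
    rewrite pE in Px; exists (g x); first exact: imset_f.
    by apply/fg; rewrite ?rP.
  by case/imsetP: Px => u Pu ->; exists (r (g u)); rewrite ?pE ?rP.
rewrite card_in_imfset => [|_ _ /imsetP[x Px ->] /imsetP[y Py ->]]; last first.
  by move/fg; rewrite !rP // => -/(_ isT isT).
by rewrite cardE.
Qed.

Lemma card_pairs n :
  #|[set [set p.1; p.2] | p : 'I_n * 'I_n & p.1 != p.2]| = 'C(n, 2).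
Proof.
rewrite -[n in RHS]card_ord -card_draws; apply: eq_card => A.
rewrite [in RHS]inE.
apply/imsetP/cards2P => [[[i j] /= ij ->]|[i [j [ij ->]]]].
  by rewrite inE in ij; exists i, j.
by exists (i, j); rewrite ?inE.
Qed.

Lemma card_pointed_pairs n :
  #|[set (t.1.1, [set t.1.2; t.2]) | t : 'I_n * 'I_n * 'I_n
     & [&& t.1.1 != t.1.2, t.1.1 != t.2 & t.1.2 != t.2]]| =
  (n * 'C(n.-1, 2))%N.
Proof.
transitivity (\sum_(i < n)
    \sum_(A in [set A : {set 'I_n} | (A \subset [set~ i]) && (#|A| == 2%N)])
    1)%N; last first.
  under eq_bigr => i _ do rewrite sum1_card cards_draws cardsC1 card_ord.
  by rewrite sum_nat_const card_ord.
rewrite pair_big_dep /= sum1_card; apply: eq_card => -[i A]; rewrite [RHS]inE /=.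
apply/imsetP/andP => [[[[i' j] l] tP [-> ->]]|[sA /cards2P[j [l [jl EA]]]]].
  move: tP; rewrite inE /= => /and3P[ij il jl].
  by rewrite subUset !sub1set !inE cards2 jl eq_sym ij eq_sym il.
exists (i, j, l); last by rewrite /= EA.
move: sA; rewrite EA subUset !sub1set !inE /= ![i == _]eq_sym jl.
by move=> /andP[-> ->].
Qed.

Lemma card_quadruples n :
  #|[set t | t : 'I_n * 'I_n * 'I_n * 'I_n
    & [&& (t.1.1.1 < t.1.1.2)%N, (t.1.1.2 < t.1.2)%N & (t.1.2 < t.2)%N]]| =
  'C(n, 4).
Proof.
rewrite imset_id cardsE -card_ltn_sorted_tuples.
pose f (t : 'I_n * 'I_n * 'I_n * 'I_n) := [tuple t.1.1.1; t.1.1.2; t.1.2; t.2].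
have f_inj : injective f.
  by move=> [[[a b] c] d] [[[a' b'] c'] d'] /(congr1 val)[] -> -> -> ->.
rewrite -(card_imset _ f_inj); apply: eq_card => t; rewrite [in RHS]inE.
apply/imsetP/idP => [[[[[a b] c] d] /= ts ->]|].
  by rewrite unfold_in /= in ts *; rewrite andbT.
case/tupleP: t => a t; case/tupleP: t => b t.
case/tupleP: t => c t; case/tupleP: t => d t.
by rewrite (tuple0 t) /= andbT => ts; exists (a, b, c, d).
Qed.

(** * Permanents of order two *)

Section OrderTwo.

Lemma ord2P (i : 'I_2) : i = 0 \/ i = 1.
Proof. by case: i => [[|[|//]]] ?; [left | right]; apply: val_inj. Qed.

Lemma perm2P (s : 'S_2) : s = 1%g \/ s = tperm 0 1.
Proof.
have : s 1 != s 0 by rewrite (inj_eq perm_inj).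
case: (ord2P (s 0)) (ord2P (s 1)) => s0 [] s1; rewrite s0 s1 ?eqxx // => _.
  by left; apply/permP => i; case: (ord2P i) => ->; rewrite perm1.
by right; apply/permP => i; case: (ord2P i) => ->; rewrite ?tpermL ?tpermR.
Qed.

Lemma permanent2 (A : comNzRingType) (M : 'M[A]_2) :
  permanent M = M 0 0 * M 1 1 + M 0 1 * M 1 0.
Proof.
rewrite /permanent (bigD1 1%g) //= (bigD1 (tperm 0 1)) /=; last first.
  by apply/eqP => /permP/(_ 0); rewrite tpermL perm1.
rewrite [X in _ + (_ + X)]big1 ?addr0 => [|s /andP[]]; last first.
  by case: (perm2P s) => ->; rewrite eqxx.
rewrite !big_ord_recl !big_ord0 !perm1 !mulr1.
by rewrite (_ : lift ord0 ord0 = 1) ?tpermL ?tpermR //; apply: val_inj.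
Qed.

Lemma increasing2 n (f : {ffun 'I_2 -> 'I_n}) :
  increasing f = (f 0%R < f 1%R)%N.
Proof.
apply/'forall_forallP/idP => [/(_ 0 1) //|lt01 a b].
by case: (ord2P a) (ord2P b) => -> [] ->.
Qed.

Lemma card_coincidences2 n (r c : {ffun 'I_2 -> 'I_n}) :
  #|[set ab : 'I_2 * 'I_2 | r ab.1 == c ab.2]| =
  ((r 0%R == c 0%R) + (r 0%R == c 1%R)
   + ((r 1%R == c 0%R) + (r 1%R == c 1%R)))%N.
Proof.
have lift1 : lift ord0 ord0 = 1 :> 'I_2 by apply: val_inj.
transitivity (\sum_(a < 2) \sum_(b < 2) (r a == c b : nat))%N.
  rewrite pair_big /= -sum1_card big_mkcond.
  by apply: eq_bigr => -[a b] _; rewrite inE; case: eqP.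
by rewrite !big_ord_recl !big_ord0 lift1 !addn0.
Qed.

Definition sorted_pair n (i j : 'I_n) : {ffun 'I_2 -> 'I_n} :=
  [ffun a : 'I_2 => if (a == 0) == (i < j)%N then i else j].

(** The triple [(i, j, l)] corresponds to the rows [{i, j}] and the columns
    [{i, l}]: the permanent does not depend on the order of rows and columns,
    so sorting them is harmless. *)
Lemma one_diag_permanentsE (A : comNzRingType) n (Y : 'M[A]_n) :
  diag_binomials Y = one_diag_permanents Y.
Proof.
apply/fsetP => h; apply/imfsetP/imfset2P => /=.
  case=> -[[i j] l] /=; rewrite inE /= => /and3P[ij il jl] ->.
  exists (sorted_pair i j) => //; exists (sorted_pair i l).
    rewrite inE /= card_coincidences2 !increasing2 !ffunE /=.
    move: ij il jl; rewrite -!(inj_eq val_inj) /=.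
    case: (ltnP i j) => lt_ij; case: (ltnP i l) => lt_il /=;
    move=> ij il jl; apply/and3P; split; lia.
  rewrite permanent2 !mxE !ffunE /=.
  by case: (ltnP i j) => lt_ij; case: (ltnP i l) => lt_il /=; ring.
move=> [r _ [c]]; rewrite inE /= card_coincidences2 !increasing2.
case/and3P=> lt_r lt_c /eqP count1 ->.
rewrite permanent2 !mxE.
have r01 : r 0 != r 1 by rewrite -(inj_eq val_inj) neq_ltn lt_r.
have c01 : c 0 != c 1 by rewrite -(inj_eq val_inj) neq_ltn lt_c.
have r10 : r 1 != r 0 by rewrite eq_sym.
have c10 : c 1 != c 0 by rewrite eq_sym.
(* [i] is the common index, [j] the other row and [l] the other column. *)
move: count1; have [e00|n00] := eqVneq (r 0) (c 0).
  have [_|n11 _] := eqVneq (r 1) (c 1).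
    by case: (r 0 == c 1) (r 1 == c 0) => [] [].
  exists (r 0, r 1, c 1); first by rewrite inE /= r01 n11 e00 c01.
  by rewrite /= -e00; ring.
have [e01|n01] := eqVneq (r 0) (c 1).
  have [_|n10 _] := eqVneq (r 1) (c 0); first by case: (r 1 == c 1).
  exists (r 0, r 1, c 0); first by rewrite inE /= r01 n10 e01 c10.
  by rewrite /= -e01; ring.
have [e10 _|_] := eqVneq (r 1) (c 0).
  exists (r 1, r 0, c 1); first by rewrite inE /= r10 e10 c01 n01.
  by rewrite /= -e10; ring.
have [e11 _|//] := eqVneq (r 1) (c 1).
exists (r 1, r 0, c 0); first by rewrite inE /= r10 e11 c10 n00.
by rewrite /= -e11; ring.
Qed.

End OrderTwo.

(** * Hafnians of order four *)

Section OrderFour.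

Definition q0 : 'I_4 := Ordinal (isT : 0 < 4)%N.
Definition q1 : 'I_4 := Ordinal (isT : 1 < 4)%N.
Definition q2 : 'I_4 := Ordinal (isT : 2 < 4)%N.
Definition q3 : 'I_4 := Ordinal (isT : 3 < 4)%N.

Lemma ord4P (i : 'I_4) : [\/ i = q0, i = q1, i = q2 | i = q3].
Proof.
case: i => [[|[|[|[|//]]]]] ?;
  by [apply: Or41; apply: val_inj | apply: Or42; apply: val_inj
     |apply: Or43; apply: val_inj | apply: Or44; apply: val_inj].
Qed.

Lemma prod_ord4 (A : comNzRingType) (F : 'I_4 -> A) :
  \prod_i F i = F q0 * (F q1 * (F q2 * F q3)).
Proof.
rewrite !big_ord_recl big_ord0 mulr1.
by congr (_ * (_ * (_ * _))); congr F; apply: val_inj.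
Qed.

Definition matching1 : 'S_4 := (tperm q0 q1 * tperm q2 q3)%g.
Definition matching2 : 'S_4 := (tperm q0 q2 * tperm q1 q3)%g.
Definition matching3 : 'S_4 := (tperm q0 q3 * tperm q1 q2)%g.

Lemma matching1E : (matching1 q0 = q1) * (matching1 q1 = q0) *
  (matching1 q2 = q3) * (matching1 q3 = q2).
Proof. by rewrite !permM !permE. Qed.

Lemma matching2E : (matching2 q0 = q2) * (matching2 q1 = q3) *
  (matching2 q2 = q0) * (matching2 q3 = q1).
Proof. by rewrite !permM !permE. Qed.

Lemma matching3E : (matching3 q0 = q3) * (matching3 q1 = q2) *
  (matching3 q2 = q1) * (matching3 q3 = q0).
Proof. by rewrite !permM !permE. Qed.

(** The partner of 0 determines the matching: the two other points have to be
    partners of each other. *)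
Lemma perfect_matchings4 (s : 'S_4) :
  [forall i, (s i != i) && (s (s i) == i)] =
  (s \in [set matching1; matching2; matching3]).
Proof.
apply/forallP/idP => [sP|]; last first.
  by rewrite !inE => /orP[/orP[]|] /eqP-> i; case: (ord4P i) => ->;
    rewrite !(matching1E, matching2E, matching3E).
have sK i : s (s i) = i by apply/eqP; case/andP: (sP i).
have sF i : s i <> i by apply/eqP; case/andP: (sP i).
have s_eq (m : 'S_4) :
    s q0 = m q0 -> s q1 = m q1 -> s q2 = m q2 -> s q3 = m q3 -> s = m.
  by move=> *; apply/permP => i; case: (ord4P i) => ->.
have [[[n0 n1] n2] n3] := (sF q0, sF q1, sF q2, sF q3).
have [[[k0 k1] k2] k3] := (sK q0, sK q1, sK q2, sK q3).
have [d01 [d02 d03]] : q0 <> q1 /\ q0 <> q2 /\ q0 <> q3 by [].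
have [d12 [d13 d23]] : q1 <> q2 /\ q1 <> q3 /\ q2 <> q3 by [].
rewrite !inE.
case: (ord4P (s q0)) => s0 //; rewrite s0 in k0.
- case: (ord4P (s q2)) => s2 //; rewrite s2 in k2; try congruence.
  by rewrite (s_eq matching1) ?eqxx // ?matching1E.
- case: (ord4P (s q1)) => s1 //; rewrite s1 in k1; try congruence.
  by rewrite (s_eq matching2) ?eqxx ?orbT // ?matching2E.
- case: (ord4P (s q1)) => s1 //; rewrite s1 in k1; try congruence.
  by rewrite (s_eq matching3) ?eqxx ?orbT // ?matching3E.
Qed.

Lemma hafnian4 (A : comNzRingType) (M : 'M[A]_4) :
  hafnian M = M q0 q1 * M q2 q3 + M q0 q2 * M q1 q3 + M q0 q3 * M q1 q2.
Proof.
rewrite /hafnian (eq_bigl _ _ perfect_matchings4).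
have ne12 : matching1 != matching2.
  by apply/eqP => /permP/(_ q0); rewrite matching1E matching2E.
have ne13 : matching1 != matching3.
  by apply/eqP => /permP/(_ q0); rewrite matching1E matching3E.
have ne23 : matching2 != matching3.
  by apply/eqP => /permP/(_ q0); rewrite matching2E matching3E.
rewrite -setUA !big_setU1 ?big_set1 ?inE ?negb_or ?ne12 ?ne13 ?ne23 //=.
rewrite addrA; congr (_ + _ + _); rewrite big_mkcond prod_ord4;
  by rewrite ?matching1E ?matching2E ?matching3E /= ?mul1r ?mulr1.
Qed.

Lemma increasing4 n (f : {ffun 'I_4 -> 'I_n}) :
  increasing f = [&& f q0 < f q1, f q1 < f q2 & f q2 < f q3]%N.
Proof.
apply/'forall_forallP/idP => [fP|/and3P[f01 f12 f23] a b].
  by apply/and3P; split; apply: (implyP (fP _ _)).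
by case: (ord4P a) (ord4P b) => -> [] -> //=; lia.
Qed.

Lemma principal_hafniansE (A : comNzRingType) n (Y : 'M[A]_n) :
  hafnian_trinomials Y = principal_hafnians Y.
Proof.
apply/fsetP => h; apply/imfsetP/imfsetP => /= -[].
  move=> [[[a b] c] d]; rewrite inE /= => /and3P[ab bc cd] ->.
  exists [ffun q : 'I_4 => nth a [:: a; b; c; d] q].
    by rewrite inE /= increasing4 !ffunE /= ab bc cd.
  by rewrite hafnian4 !mxE !ffunE.
move=> f; rewrite inE /= increasing4 => fP ->.
exists (f q0, f q1, f q2, f q3); first by rewrite inE.
by rewrite hafnian4 !mxE.
Qed.

End OrderFour.

(** * Degrees and cardinals of the four families *)

Section Families.
Variables (k : fieldType) (n : nat).
Local Notation X := (genericsym k n).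

Lemma msize_diag_monomial h : h \in diag_monomials X -> msize h = 3%N.
Proof. by case/imfset2P => i _ [j _ ->]; rewrite msize_genericsymM. Qed.

Lemma card_diag_monomials : #|` diag_monomials X| = (n ^ 2)%N.
Proof.
have -> : diag_monomials X = [fset X p.1 p.1 * X p.1 p.2 | p : 'I_n * 'I_n].
  apply/fsetP => h; apply/imfset2P/imfsetP => /= [[i _ [j _ ->]]|[[i j] _ ->]].
    by exists (i, j).
  by exists i => //; exists j.
rewrite (@card_imfset_fibers _ _ _ _ _ [set: 'I_n * 'I_n] _ id).
- by rewrite imset_id cardsT card_prod card_ord.
- by move=> p; rewrite in_setT.
move=> [i j] [i' j'] _ _ /=; split=> [E|[-> ->] //].
have := mcoeff_diag_monomial k i j i' j'.
by rewrite -E mcoeff_diag_monomial eqxx => /esym/natr_bool_eq1/eqP.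
Qed.

Lemma msize_square_binomial h : h \in square_binomials X -> msize h = 3%N.
Proof.
case/imfsetP => -[i j] /=; rewrite inE /= => ij ->.
apply: (@msize_quadric _ _ _ i j i j).
  by rewrite mulr_natl mulr2n expr2 !msize_quadricD // msize_genericsymM.
by rewrite mcoeff_square_binomial // /sameedge !eqxx oner_eq0.
Qed.

Lemma card_square_binomials : #|` square_binomials X| = 'C(n, 2).
Proof.
rewrite -card_pairs; apply: card_imfset_fibers => [t|].
  by rewrite [RHS]inE.
move=> [i j] [i' j']; rewrite !inE /= => ij ij'; split=> [E|/eqP].
  have := mcoeff_square_binomial k i' j' ij.
  rewrite -E mcoeff_square_binomial // sameedge_set eqxx => /esym/natr_bool_eq1.
  by rewrite sameedge_set => /eqP.
rewrite eq_set2 => /orP[]/andP[/eqP-> /eqP->] //.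
by rewrite (genericsymC _ j') [X j' j' * _]mulrC.
Qed.

Lemma msize_diag_binomial h : h \in diag_binomials X -> msize h = 3%N.
Proof.
case/imfsetP => -[[i j] l] /=; rewrite inE /= => ijl ->.
apply: (@msize_quadric _ _ _ j l i i).
  by rewrite msize_quadricD // msize_genericsymM.
have [_ _ jl] := and3P ijl.
by rewrite mcoeff_diag_binomial // /sameedge !eqxx oner_eq0.
Qed.

Lemma card_diag_binomials : #|` diag_binomials X| = (n * 'C(n.-1, 2))%N.
Proof.
rewrite -card_pointed_pairs; apply: card_imfset_fibers => [t|].
  by rewrite [RHS]inE.
move=> [[i j] l] [[i' j'] l']; rewrite !inE /= => ijl ijl'; split=> [E|[<- /eqP]].
  have [_ _ jl] := and3P ijl; have := mcoeff_diag_binomial k i ijl' jl.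
  rewrite -E mcoeff_diag_binomial // sameedge_set !eqxx /=.
  move=> /esym/natr_bool_eq1.
  by rewrite sameedge_set => /andP[/eqP-> /eqP->].
rewrite eq_set2 => /orP[]/andP[/eqP-> /eqP->] //.
rewrite (genericsymC _ j' l') [X l' i * _]mulrC.
by rewrite (genericsymC _ i l') (genericsymC _ i j').
Qed.

Lemma msize_hafnian_trinomial h : h \in hafnian_trinomials X -> msize h = 3%N.
Proof.
case/imfsetP => -[[[a b] c] d] /=; rewrite inE /= => abcd ->.
apply: (@msize_quadric _ _ _ a b c d).
  by rewrite !msize_quadricD // msize_genericsymM.
by rewrite mcoeff_hafnian_trinomial // eqxx oner_eq0.
Qed.

Lemma card_hafnian_trinomials : #|` hafnian_trinomials X| = 'C(n, 4).
Proof.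
rewrite -card_quadruples; apply: card_imfset_fibers => [t|].
  by rewrite [RHS]inE.
move=> [[[a b] c] d] [[[a' b'] c'] d']; rewrite !inE /= => lt_t lt_t'.
split=> [E|[-> -> -> ->] //].
have := mcoeff_hafnian_trinomial k lt_t lt_t'.
by rewrite -E mcoeff_hafnian_trinomial // eqxx => /esym/natr_bool_eq1/eqP.
Qed.

End Families.

Theorem proposition3p1 (k : fieldType) (n : nat)
    (k_infinite : infinite_type k)
    (k_char : [pchar k] =i pred0 \/ exists2 p : nat, p \in [pchar k] & (2 < p)%N) :
  let X : 'M[symR k n]_n := genericsym k n in
  let Y : 'M[symS k n]_n := genericsym k n in
  let I : {pred symS k n} := Ann (\det X) in
  [/\ (* (a) *)
      [/\ forall i j : 'I_n, Y i i * Y i j \in I,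
          forall h, h \in diag_monomials Y -> msize h = 3%N
        & #|` diag_monomials Y| = (n ^ 2)%N],
      (* (b) *)
      [/\ forall i j : 'I_n, i != j ->
            Y i j ^+ 2 + 2 * (Y i i * Y j j) \in I,
          forall h, h \in square_binomials Y -> msize h = 3%N
        & #|` square_binomials Y| = 'C(n, 2)],
      (* (c) *)
      [/\ forall i j l : 'I_n, i != j -> i != l -> j != l ->
            Y j i * Y i l + Y j l * Y i i \in I,
          forall h, h \in diag_binomials Y -> msize h = 3%N,
          diag_binomials Y = one_diag_permanents Y
        & #|` diag_binomials Y| = (n * 'C(n.-1, 2))%N]
    & (* (d) *)
      [/\ forall i1 i2 i3 i4 : 'I_n, (i1 < i2)%N -> (i2 < i3)%N -> (i3 < i4)%N ->
            Y i1 i2 * Y i3 i4 + Y i1 i3 * Y i2 i4 + Y i1 i4 * Y i2 i3 \in I,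
          forall h, h \in hafnian_trinomials Y -> msize h = 3%N,
          hafnian_trinomials Y = principal_hafnians Y
        & #|` hafnian_trinomials Y| = 'C(n, 4)]].
Proof.
move=> X Y I; rewrite /X /Y /I; split; split.
- exact: diag_monomial_Ann.
- exact: msize_diag_monomial.
- exact: card_diag_monomials.
- exact: square_binomial_Ann.
- exact: msize_square_binomial.
- exact: card_square_binomials.
- exact: diag_binomial_Ann.
- exact: msize_diag_binomial.
- exact: one_diag_permanentsE.
- exact: card_diag_binomials.
- move=> i1 i2 i3 i4 lt12 lt23 lt34; apply: hafnian_trinomial_Ann.
  apply: (@map_uniq _ _ (val : 'I_n -> nat)); apply: (sorted_uniq ltn_trans ltnn).
  by rewrite /= lt12 lt23 lt34.
- exact: msize_hafnian_trinomial.
- exact: principal_hafniansE.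
- exact: card_hafnian_trinomials.
Qed.
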